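(* Consider the control system $\dot z=-z,\ \dot c=0,\ \dot y=-y+zu$, $u\in U=[-1,1]$, on $M=\mathbb R^3$ (coordinates $(z,c,y)$) with the Euclidean metric, and let $K:=\{(1,c,0):c\in C\}$ and $Q:=\{(z,c,F(z,c)):z\in[0,1],\ c\in C\}$, where $C$ is the middle-third Cantor set and $F$ is the matching function defined in the context; $K$ and $Q$ are compact. Then $K\subseteq Q$, $Q$ is weakly invariant, $h_{\mathrm{inv}}(K,Q)=0$, and $h_{\mathrm{inv}}^*(K,Q)=\log 2$. In particular, finite strict invariance entropy need not coincide with ordinary invariance entropy: here $h_{\mathrm{inv}}^*(K,Q)<\infty$ and $h_{\mathrm{inv}}(K,Q)\neq h_{\mathrm{inv}}^*(K,Q)$.
   Context: Coding. $\Sigma:=\{-1,1\}^{\mathbb N}$, with indices $j\ge 1$; $\pi:\Sigma\to[0,1]$, $\pi(\omega):=\sum_{j=1}^\infty\frac{\omega_j+1}{3^j}$, which is injective; $C:=\pi(\Sigma)$ is the standard middle-third Cantor set. For $c\in C$, $\sigma(c)=(\sigma_1(c),\sigma_2(c),\ldots):=\pi^{-1}(c)\in\Sigma$. Matching function. For $c\in C$ let $a(t,c):=\sigma_j(c)$ for $t\in[j-1,j)$, $j\ge1$; $q(t,c):=\int_0^t a(s,c)\,ds$ for $t\ge0$; and define $F:[0,1]\times C\to\mathbb R$ by $F(z,c):=z\,q(-\log z,c)$ for $z>0$ and $F(0,c):=0$. Controls and trajectories. $\log$ is the natural logarithm. Admissible controls are the Lebesgue measurable functions $u:[0,\infty)\to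 U=[-1,1]$, identified when equal a.e.; their set is $\mathcal U$. For $x\in M$, $u\in\mathcal U$, $\varphi(t,x,u)$, $t\ge 0$, denotes the Carathéodory solution with initial value $x$ at time $0$ under control $u$. Invariance. A compact set $Q\subseteq M$ is weakly invariant if for every $x\in Q$ there is $u\in\mathcal U$ with $\varphi(t,x,u)\in Q$ for all $t\ge0$. For $\varepsilon>0$, $N_\varepsilon(Q):=\{x\in M:\operatorname{dist}(x,Q)<\varepsilon\}$, where $\operatorname{dist}(x,Q)=\inf_{p\in Q}d(x,p)$. Entropies. Let $K\subseteq Q$ be compact and $T>0$. A finite $S\subseteq\mathcal U$ is $(T,K,Q)$-spanning if for every $x\in K$ there is $u\in S$ with $\varphi(t,x,u)\in Q$ for all $t\in[0,T]$; $r_{\mathrm{inv}}^*(T,K,Q)$ is the smallest cardinality of such a set ($\infty$ if none exists). A finite $S\subseteq\mathcal U$ is $(T,\varepsilon,K,Q)$-spanning if for every $x\in K$ there is $u\in S$ with $\varphi(t,x,u)\in N_\varepsilon(Q)$ for all $t\in[0,T]$; $r_{\mathrm{inv}}(T,\varepsilon,K,Q)$ is the smallest cardinality of such a set ($\infty$ if none exists). With $\log\infty=\infty$, the strict invariance entropy is $h_{\mathrm{inv}}^*(K,Q):=\limsup_{T\to\infty}\frac1T\log r_{\mathrm{inv}}^*(T,K,Q)$; further $h_{\mathrm{inv}}(\varepsilon,K,Q):=\limsup_{T\to\infty}\frac1T\log r_{\mathrm{inv}}(T,\varepsilon,K,Q)$, and the (ordinary) invariance entropy is $h_{\mathrm{inv}}(K,Q):=\lim_{\varepsilon\downarrow0}h_{\mathrm{inv}}(\varepsilon,K,Q)$,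 which exists in $[0,\infty]$ by monotonicity. *)

(* Defs.v *)
From HB Require Import structures.
From mathcomp Require Import all_boot all_order all_algebra finmap.
From mathcomp Require Import generic_quotient.
From mathcomp Require Import all_classical all_reals all_analysis.

Set Implicit Arguments.
Unset Strict Implicit.
Unset Printing Implicit Defensive.

Import Order.TTheory GRing.Theory Num.Theory.
Import numFieldNormedType.Exports.

Local Open Scope classical_set_scope.
Local Open Scope ring_scope.

(* Lebesgue (not only Borel) measurability: the real line carries here the
   completed sigma-algebra, and all integrals are taken with respect to the
   completed Lebesgue measure. *)
Notation lebT R := (caratheodory_type (@wlength R idfun)^*%mu).
Definition lambda (R : realType) : {measure set (lebT R) -> \bar R} :=
  @completed_lebesgue_measure R.

Section controls.
Variables (R : realType) (U : set R).

(* A control is defined on [0, +oo[ only: its values at negative times are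
   unconstrained, and they are forgotten by the quotient below. *)
Definition admissible : set (R -> R) :=
  [set u | measurable_fun (`[0, +oo[ : set (lebT R)) (u : lebT R -> R) /\
           forall t : R, 0 <= t -> U (u t)].

Definition ae_equal (u v : admissible) : bool :=
  `[< {ae lambda R, forall t : R, 0 <= t -> set_val u t = set_val v t} >].

Let ae_equal_refl : reflexive ae_equal.
Proof. by move=> u; apply/asboolP; apply: aeW. Qed.

Let ae_equal_sym : symmetric ae_equal.
Proof.
have ae_filter := ae_filter_ringOfSetsType (lambda R).
by move=> u v; apply/idP/idP => /asboolP uv; apply/asboolP;
  apply: filterS uv => t h t0; rewrite h.
Qed.

Let ae_equal_trans : transitive ae_equal.
Proof.
have ae_filter := ae_filter_ringOfSetsType (lambda R).
move=> v u w /asboolP uv /asboolP vw; apply/asboolP.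
by apply: filterS2 uv vw => t h1 h2 t0; rewrite h1// h2.
Qed.

Canonical ae_equal_equiv :=
  EquivRel ae_equal ae_equal_refl ae_equal_sym ae_equal_trans.

Definition control : Type := {eq_quot ae_equal}%qT.
HB.instance Definition _ := Choice.on control.
HB.instance Definition _ := EqQuotient.on control.

Definition control_fun (u : control) : R -> R :=
  set_val (repr u : admissible).
Coercion control_fun : control >-> Funclass.

End controls.

Section control_systems.
Variables (R : realType) (n : nat).
Implicit Types (x p : 'rV[R]_n) (K Q A : set 'rV[R]_n).

(* The library norm on 'rV[R]_n is the sup norm, hence the explicit Euclidean
   distance; both induce the same topology. *)
Definition eucl_dist x p : R :=
  Num.sqrt (\sum_(i < n) (x ord0 i - p ord0 i) ^+ 2).

Definition dist_to x Q : \bar R :=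
  ereal_inf [set (eucl_dist x p)%:E | p in Q].

Definition nbhd (eps : R) Q : set 'rV[R]_n :=
  [set x | (dist_to x Q < eps%:E)%E].

Variables (U : set R) (f : 'rV[R]_n -> R -> 'rV[R]_n).

(* Integral form of "absolutely continuous on compact intervals, with
   phi' = f(phi, u) almost everywhere and phi(0) = x". *)
Definition caratheodory_solution x (u : R -> R) (phi : R -> 'rV[R]_n) : Prop :=
  forall t : R, 0 <= t -> forall i : 'I_n,
    (lambda R).-integrable (`[0, t] : set (lebT R))
      (fun s => (f (phi s) (u s) ord0 i)%:E) /\
    phi t ord0 i = x ord0 i +
      \int[lambda R]_(s in (`[0, t] : set (lebT R))) f (phi s) (u s) ord0 i.

(* "phi(t, x, u) lies in A for all t in I"; the existence of the solution is
   part of the assertion. *)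
Definition stays_in (I : set R) A x (u : control U) : Prop :=
  exists2 phi, caratheodory_solution x u phi & forall t, I t -> A (phi t).

Definition weakly_invariant Q : Prop :=
  forall x, Q x -> exists u : control U, stays_in `[0, +oo[ Q x u.

Definition spanning (T : R) K A (S : {fset control U}) : Prop :=
  forall x, K x -> exists2 u, u \in S & stays_in `[0, T] A x u.

Definition min_card_spanning (T : R) K A : \bar R :=
  ereal_inf [set (#|` S|%:R)%:E | S in spanning T K A].

Definition r_inv_strict (T : R) K Q := min_card_spanning T K Q.

Definition r_inv (T eps : R) K Q := min_card_spanning T K (nbhd eps Q).

Definition h_inv_strict K Q : \bar R :=
  limf_esup (fun T : R => T^-1%:E * lne (r_inv_strict T K Q))%E
            (pinfty_nbhs R).

Definition h_inv_eps (eps : R) K Q : \bar R :=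
  limf_esup (fun T : R => T^-1%:E * lne (r_inv T eps K Q))%E (pinfty_nbhs R).

Definition h_inv K Q : \bar R :=
  lim (h_inv_eps eps K Q @[eps --> 0^'+]).

End control_systems.

Section matching.
Variable R : realType.

(* Sequences are indexed from 0: [w j] is the symbol of index j + 1. *)
Definition Sigma : set (nat -> R) := [set w | forall j, w j = -1 \/ w j = 1].

Definition coding (w : nat -> R) : R :=
  limn (series (fun j => (w j + 1) / 3 ^+ j.+1)).

Definition Cantor : set R := coding @` Sigma.

Definition symbols (c : R) : nat -> R := pinv Sigma coding c.

(* [truncn t] is j - 1 for t in [j - 1, j[. *)
Definition symbol_at (t c : R) : R := symbols c (Num.truncn t).

Definition matching_q (t c : R) : R :=
  \int[lambda R]_(s in (`[0, t] : set (lebT R))) symbol_at s c.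

Definition matching_F (z c : R) : R :=
  if 0 < z then z * matching_q (- ln z) c else 0.

End matching.

Arguments Sigma : clear implicits.
Arguments Cantor : clear implicits.

Section example.
Variable R : realType.

Definition vec3 (z c y : R) : 'rV[R]_3 := \row_(i < 3) [:: z; c; y]`_i.

Definition Urange : set R := `[-1, 1].

Definition field (x : 'rV[R]_3) (w : R) : 'rV[R]_3 :=
  let z := x ord0 0 in let y := x ord0 2 in
  vec3 (- z) 0 (- y + z * w).

Definition Kset : set 'rV[R]_3 := [set vec3 1 c 0 | c in Cantor R].

Definition Qset : set 'rV[R]_3 :=
  [set vec3 z c (matching_F z c) | z in `[0, 1] & c in Cantor R].

End example.

Arguments Urange : clear implicits.
Arguments field : clear implicits.
Arguments Kset : clear implicits.
Arguments Qset : clear implicits.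

(* Main.v *)
(* Along a trajectory starting at (1, c, 0) one has z(t) = e^-t and
   y(t) = e^-t int_0^t u, so it stays in Q up to time T iff int_0^t u = q(t, c)
   for all t <= T.  Since q(., c) has slope sigma_j(c) on [j - 1, j], such a
   control determines the first floor(T) symbols of c, and conversely it may be
   chosen as a function of the first ceil(T) of them: between 2^floor(T) and
   2^ceil(T) controls are needed.  If only an eps-neighbourhood of Q has to be
   reached, the factor e^-t makes all symbols after a time depending on eps
   irrelevant, so a number of controls independent of T suffices.

   Both existence and uniqueness of the y-component come from the remark that
   a function whose increments are O((t - s)^2) is constant; this avoids
   differentiating integrals with respect to the completed measure. *)
Require Import Defs.
From mathcomp Require Import all_boot all_order all_algebra finmap.
From mathcomp Require Import generic_quotient.
From mathcomp Require Import all_classical all_reals all_analysis.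
From mathcomp Require Import measurable_realfun.
From mathcomp Require Import ring lra.

Set Implicit Arguments.
Unset Strict Implicit.
Unset Printing Implicit Defensive.

Import Order.TTheory GRing.Theory Num.Theory.
Import numFieldNormedType.Exports.

Local Open Scope classical_set_scope.
Local Open Scope ring_scope.

(** * Primitives for the completed Lebesgue measure *)

(** Convertible to [matching_q] and to the integrals in [caratheodory_solution], so that folding
    suffices to pass between them. *)
Definition primitive (R : realType) (f : R -> R) (t : R) : R :=
  \int[lambda R]_(s in (`[0, t] : set (lebT R))) f s.

Definition integrable_upto (R : realType) (f : R -> R) (t : R) : Prop :=
  (lambda R).-integrable (`[0, t] : set (lebT R)) (fun s => (f s)%:E).

Lemma borel_measurable_lebT (R : realType) (A : set R) :
  measurable (A : set (measurableTypeR R)) -> measurable (A : set (lebT R)).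
Proof. exact: sub_caratheodory. Qed.

Lemma lambda_lebesgue (R : realType) (A : set R) :
  lambda R A = lebesgue_measure A.
Proof. by []. Qed.

Lemma measurable_itv_lebT (R : realType) (i : interval R) :
  measurable ([set` i] : set (lebT R)).
Proof. by apply: borel_measurable_lebT; exact: measurable_itv. Qed.

Lemma borel_measurable_fun_lebT (R : realType) (D : set R) (f : R -> R) :
  measurable (D : set (lebT R)) ->
  measurable_fun (setT : set (measurableTypeR R)) f ->
  measurable_fun (D : set (lebT R)) (f : lebT R -> R).
Proof.
move=> mD mf _ B mB; apply: measurableI => //.
by apply: borel_measurable_lebT; rewrite -[_ @^-1` _]setTI; exact: mf.
Qed.

Lemma bounded_integrable_upto (R : realType) (f : R -> R) (M t : R) :
  measurable_fun (`[0, +oo[ : set (lebT R)) (f : lebT R -> R) ->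
  (forall s, 0 <= s <= t -> `|f s| <= M) -> integrable_upto f t.
Proof.
move=> mf fM; apply: measurable_bounded_integrable.
- exact: measurable_itv_lebT.
- change (lambda R (`[0%R, t]%classic : set R) < +oo)%E.
  by rewrite lambda_lebesgue lebesgue_measure_itv/=; case: ifP => // _; rewrite -EFinB ltry.
- apply: measurable_funS mf => //; first exact: measurable_itv_lebT.
  by move=> s /=; rewrite !in_itv/= => /andP[-> _].
- exists M; split; first exact: num_real.
  move=> N MN s /=; rewrite in_itv/= => /fM; move=> h; apply: (le_trans h); exact: ltW.
Qed.

Lemma lambda_Rintegral_set1 (R : realType) (f : R -> R) (t : R) :
  \int[lambda R]_(s in ([set t] : set (lebT R))) f s = 0.
Proof.
have mt : measurable ([set t] : set (lebT R)).
  by rewrite -set_itv1; exact: measurable_itv_lebT.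
rewrite /Rintegral (eq_integral (fun=> (f t)%:E)); last first.
  by move=> x; rewrite inE => ->.
rewrite integral_cst//=.
by rewrite [X in (_ * X)%E]lebesgue_measure_set1 mule0.
Qed.

(** The domain of integration is empty or a point. This yields the initial values at time 0 and, as
    [- ln z <= 0] there, the vanishing of [matching_F] for [z >= 1]. *)
Lemma primitive_le0 (R : realType) (f : R -> R) (t : R) :
  t <= 0 -> primitive f t = 0.
Proof.
move=> t0; rewrite /primitive.
have [->|t_neq0] := eqVneq t 0; first by rewrite set_itv1 lambda_Rintegral_set1.
rewrite set_itv_ge ?Rintegral_set0// bnd_simp -ltNge lt_neqAle t_neq0.
by rewrite t0.
Qed.

(** A mean value estimate replacing differentiation. The bound is asked on the open interval only,
    so that jumps of a step function at the ends are harmless; [e = 0] then gives exact increments,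
    and [k = 0] a Lipschitz bound. *)
Lemma primitive_increment (R : realType) (f : R -> R) (s t k e : R) :
  0 <= s <= t -> integrable_upto f t ->
  (forall r, s < r < t -> `|f r - k| <= e) ->
  `|primitive f t - primitive f s - k * (t - s)| <= e * (t - s).
Proof.
move=> /andP[s0 st] fi fk.
have [->|s_neq_t] := eqVneq s t; first by rewrite !subrr !mulr0 subr0 normr0.
have {s_neq_t}st : s < t by rewrite lt_neqAle s_neq_t.
pose mi := @measurable_itv_lebT R.
have fiS (i : interval R) : {subset i <= `[0, t]} ->
    (lambda R).-integrable ([set` i] : set (lebT R)) (EFin \o f).
  move=> sub; apply: integrableS fi; [exact: mi|exact: mi|].
  by move=> x /=; exact: sub.
have -> : primitive f t = primitive f s +
    \int[lambda R]_(r in (`]s, t[ : set (lebT R))) f r.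
  rewrite /primitive.
  (* The point [t] is split off as a null set, which leaves the open interval on which [f] is
     controlled. *)
  have ->: `[0, t]%classic = (`[0, s] `|` `]s, t[) `|` [set t] :> set (lebT R).
    apply/seteqP; split => x /=; rewrite !in_itv/=.
      move=> /andP[x0]; rewrite le_eqVlt => /predU1P[->|xt]; first by right.
      left; have [xs|sx] := leP x s; first by left; rewrite x0.
      by right.
    move=> [[/andP[-> xs]|/andP[sx xt]]|->].
    - by rewrite (le_trans xs (ltW st)).
    - by rewrite (ltW xt) (le_trans s0 (ltW sx)).
    - by rewrite lexx (le_trans s0 (ltW st)).
  have sub0t : `[0, s] `|` `]s, t[ `<=` (`[0, t] : set (lebT R)).
    move=> x /=; rewrite !in_itv/= => -[/andP[-> xs]|/andP[sx xt]].
      by rewrite (le_trans xs (ltW st)).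
    by rewrite (ltW xt) (le_trans s0 (ltW sx)).
  have mU : measurable (`[0, s] `|` `]s, t[ : set (lebT R)).
    by apply: measurableU; exact: mi.
  have mt : measurable ([set t] : set (lebT R)) by rewrite -set_itv1; exact: mi.
  rewrite Rintegral_setU//; first last.
  - apply/disj_setPS => x /= [xU xt]; move: xU; rewrite xt !in_itv/=.
    by rewrite ltxx andbF => -[/andP[_]|//]; rewrite leNgt st.
  - apply: integrableS fi; [exact: mi|exact: measurableU|].
    move=> x [/sub0t//|->]/=.
    by rewrite in_itv/= lexx (le_trans s0 (ltW st)).
  rewrite lambda_Rintegral_set1 addr0 Rintegral_setU//; try exact: mi.
  - by apply: integrableS fi => //; exact: mi.
  - apply/disj_setPS => x /= []; rewrite !in_itv/= => /andP[_ xs] /andP[sx _].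
    by move: sx; rewrite ltNge xs.
have mst := mi `]s, t[.
have fist : (lambda R).-integrable (`]s, t[ : set (lebT R)) (EFin \o f).
  apply: fiS => x; rewrite !in_itv/= => /andP[sx xt].
  by rewrite (ltW xt) (le_trans s0 (ltW sx)).
have lst : fine (lambda R (`]s, t[%classic : set R)) = t - s.
  by rewrite lambda_lebesgue lebesgue_measure_itv/= lte_fin st.
have cst_int (r : R) : (lambda R).-integrable (`]s, t[ : set (lebT R)) (EFin \o fun=> r).
  apply: measurable_bounded_integrable => //.
    change (lambda R (`]s, t[%classic : set R) < +oo)%E.
    by rewrite lambda_lebesgue lebesgue_measure_itv/= lte_fin st -EFinB ltry.
  by exists `|r|; split=> [|N rN x _]; [exact: num_real|exact: ltW].
have cstE (r : R) : \int[lambda R]_(x in (`]s, t[ : set (lebT R))) r = r * (t - s).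
  by rewrite Rintegral_cst// -lst.
rewrite (addrC (primitive f s)) addrK ler_norml -mulNr -!cstE.
have fk_int : (lambda R).-integrable (`]s, t[ : set (lebT R))
    (EFin \o fun x => f x - k) by exact: (integrableB mst fist (cst_int k)).
have {}fk x : `]s, t[%classic x -> - e <= f x - k <= e.
  by rewrite /= in_itv/= => /fk; rewrite ler_norml.
by rewrite -RintegralB//; apply/andP; split; apply: le_Rintegral => // x /fk/andP[].
Qed.

Lemma primitive_lipschitz (R : realType) (f : R -> R) (M s t : R) :
  0 <= s <= t -> integrable_upto f t -> (forall r, 0 <= r -> `|f r| <= M) ->
  `|primitive f t - primitive f s| <= M * (t - s).
Proof.
move=> st fi fM; have /andP[s0 _] := st.
have := @primitive_increment R f s t 0 M st fi; rewrite mul0r subr0; apply.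
by move=> r /andP[sr _]; rewrite subr0 fM// (le_trans s0 (ltW sr)).
Qed.

Lemma primitiveB (R : realType) (f g : R -> R) (t : R) :
  integrable_upto f t -> integrable_upto g t ->
  primitive (fun s => f s - g s) t = primitive f t - primitive g t.
Proof. by move=> fi gi; rewrite /primitive RintegralB//; exact: measurable_itv_lebT. Qed.

Lemma primitiveZ (R : realType) (f : R -> R) (k t : R) :
  integrable_upto f t -> primitive (fun s => k * f s) t = k * primitive f t.
Proof. by move=> fi; rewrite /primitive RintegralZl//; exact: measurable_itv_lebT. Qed.

Lemma integrable_uptoB (R : realType) (f g : R -> R) (t : R) :
  integrable_upto f t -> integrable_upto g t ->
  integrable_upto (fun s => f s - g s) t.
Proof. by move=> fi gi; apply: (integrableB _ fi gi); exact: measurable_itv_lebT. Qed.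

Lemma integrable_uptoZ (R : realType) (f : R -> R) (k t : R) :
  integrable_upto f t -> integrable_upto (fun s => k * f s) t.
Proof. by move=> fi; apply: (integrableZl _ k fi); exact: measurable_itv_lebT. Qed.

Lemma eq_primitive (R : realType) (f g : R -> R) (t : R) :
  (forall s, 0 <= s <= t -> f s = g s) -> primitive f t = primitive g t.
Proof. by move=> fg; apply: eq_Rintegral => s; rewrite inE/= in_itv; exact: fg. Qed.

Lemma eq_integrable_upto (R : realType) (f g : R -> R) (t : R) :
  (forall s, 0 <= s <= t -> f s = g s) -> integrable_upto f t -> integrable_upto g t.
Proof.
move=> fg; apply: eq_integrable; first exact: measurable_itv_lebT.
by move=> s; rewrite inE/= in_itv/= => /fg ->.
Qed.

Lemma primitive_continuous (R : realType) (f : R -> R) (M : R) :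
  (forall t, integrable_upto f t) -> (forall r, 0 <= r -> `|f r| <= M) ->
  continuous (primitive f).
Proof.
move=> fi fM.
have M0 : 0 <= M by apply: le_trans (fM 0 _).
have lip s t : s <= t -> `|primitive f t - primitive f s| <= M * (t - s).
  move=> st; have [s0|/ltW s0] := leP 0 s.
    by apply: primitive_lipschitz => //; rewrite s0.
  have [t0|/ltW t0] := leP 0 t; last first.
    by rewrite !primitive_le0// subrr normr0 mulr_ge0// subr_ge0.
  (* When [s <= 0 <= t], the increment from [s] is the one from 0, and [t - 0 <= t - s]. *)
  rewrite (primitive_le0 _ s0) -(primitive_le0 f (lexx 0)).
  rewrite (le_trans (@primitive_lipschitz _ _ M 0 t _ _ _))//; first by rewrite lexx.
  by rewrite ler_wpM2l// lerD2l lerN2.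
have {}lip s t : `|primitive f t - primitive f s| <= M * `|t - s|.
  have [st|/ltW ts] := leP s t.
    by have /ger0_norm-> : 0 <= t - s; rewrite ?subr_ge0 ?lip.
  rewrite distrC (distrC t).
  by have /ger0_norm-> : 0 <= s - t; rewrite ?subr_ge0 ?lip.
move=> x; apply/cvgrPdist_le => e e0; near=> y.
rewrite (le_trans (lip _ _))//.
(* [M + 1] instead of [M], which may be 0. *)
have : `|x - y| <= e / (M + 1).
  near: y; apply: cvgr_dist_le; first exact: cvg_id.
  by rewrite divr_gt0// ltr_wpDl.
rewrite ler_pdivlMr ?ltr_wpDl//; have := normr_ge0 (x - y); lra.
Unshelve. all: by end_near. Qed.

(** * The equation y' = - y + b e^-t u *)

(** Cutting $[0,t]$ into $n+1$ equal pieces bounds the total increment by $(n+1)\,C\,(t/(n+1))^2 = C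
    t^2/(n+1)$, which tends to 0. *)
Lemma quadratic_increment_constant (R : realType) (H : R -> R) (C T : R) :
  (forall s t, 0 <= s <= t -> t <= T -> `|H t - H s| <= C * (t - s) ^+ 2) ->
  forall t, 0 <= t <= T -> H t = H 0.
Proof.
move=> HC t /andP[t0 tT].
have bound n : `|H t - H 0| <= C * t ^+ 2 / n.+1%:R.
  pose h := t / n.+1%:R.
  have h0 : 0 <= h by rewrite divr_ge0.
  have nh : n.+1%:R * h = t by rewrite /h mulrCA divff ?mulr1// pnatr_eq0.
  have step k : (k <= n.+1)%N -> `|H (k%:R * h) - H 0| <= k%:R * (C * h ^+ 2).
    elim: k => [_|k IH kn]; first by rewrite !mul0r subrr normr0.
    have -> : H (k.+1%:R * h) - H 0 =
      (H (k.+1%:R * h) - H (k%:R * h)) + (H (k%:R * h) - H 0) by ring.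
    rewrite (le_trans (ler_normD _ _))//.
    have -> : k.+1%:R * (C * h ^+ 2) = C * h ^+ 2 + k%:R * (C * h ^+ 2).
      by rewrite -natr1; ring.
    apply: lerD; last exact/IH/ltnW.
    have -> : h ^+ 2 = (k.+1%:R * h - k%:R * h) ^+ 2 by rewrite -natr1; ring.
    apply: HC.
      by rewrite mulr_ge0//= ler_wpM2r// ler_nat.
    by rewrite (le_trans _ tT)// -nh ler_wpM2r// ler_nat.
  have := step n.+1 (leqnn _); rewrite nh.
  suff -> : n.+1%:R * (C * h ^+ 2) = C * t ^+ 2 / n.+1%:R by [].
  by rewrite /h; field; rewrite nat1r pnatr_eq0.
apply/eqP; rewrite -subr_eq0 -normr_le0; apply/ler_addgt0Pr => e e0.
rewrite add0r (le_trans (bound (Num.trunc (C * t ^+ 2 / e))))//.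
by rewrite ler_pdivrMr// [leRHS]mulrC -ler_pdivrMr// ltW// truncnS_gt.
Qed.

(** From $1-h \le e^{-h} \le 1/(1+h) \le 1-h+h^2$. *)
Lemma expRN_increment (R : realType) (h : R) : 0 <= h ->
  `|expR (- h) - 1 + h| <= h ^+ 2.
Proof.
move=> h0; have h1 : 0 < 1 + h by lra.
have e1 : 1 - h <= expR (- h) by exact: expR_ge1Dx.
have e2 : expR (- h) <= (1 + h)^-1.
  by rewrite expRN lef_pV2 ?posrE ?expR_gt0// expR_ge1Dx.
have e3 : (1 + h)^-1 <= 1 - h + h ^+ 2.
  by rewrite -div1r ler_pdivrMr//; nra.
by rewrite ger0_norm; lra.
Qed.

Lemma expRN_lipschitz (R : realType) (s t : R) : 0 <= s <= t ->
  `|expR (- t) - expR (- s)| <= t - s.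
Proof.
move=> /andP[s0 st].
have -> : expR (- t) - expR (- s) = expR (- s) * (expR (- (t - s)) - 1).
  by rewrite mulrBr mulr1 -expRD; congr (expR _ - _); ring.
have es : expR (- s) <= 1 by rewrite expR_le1; lra.
have e1 := expR_ge1Dx (- (t - s)).
have e2 : expR (- (t - s)) <= 1 by rewrite expR_le1; lra.
rewrite normrM (ger0_norm (expR_ge0 _)) ler0_norm; last by lra.
have := expR_ge0 (- s); nra.
Qed.

Lemma continuous_measurable_lebT (R : realType) (f : R -> R) :
  continuous f ->
  measurable_fun (`[0, +oo[ : set (lebT R)) (f : lebT R -> R).
Proof.
move=> cf; apply: borel_measurable_fun_lebT; first exact: measurable_itv_lebT.
exact: continuous_measurable_fun.
Qed.

(* The increments of both sides differ by a quadratic error, [u] entering them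
   only through [primitive u]. *)
Lemma relaxation_solution (R : realType) (u : R -> R) (a b : R) :
  measurable_fun (`[0, +oo[ : set (lebT R)) (u : lebT R -> R) ->
  (forall t, 0 <= t -> `|u t| <= 1) ->
  let y t := expR (- t) * (a + b * primitive u t) in
  let g t := - y t + b * expR (- t) * u t in
  forall t, 0 <= t -> integrable_upto g t /\ y t = a + primitive g t.
Proof.
move=> mu u1 y g T T0.
have ui t : integrable_upto u t.
  by apply: (@bounded_integrable_upto _ _ 1) => // s /andP[s0 _]; exact: u1.
pose G := primitive u.
have G0 : G 0 = 0 by exact: primitive_le0.
have Glip (s t : R) : 0 <= s <= t -> `|G t - G s| <= t - s.
  by move=> st; rewrite -[leRHS]mul1r; exact: primitive_lipschitz.
have Gb (t : R) : 0 <= t -> `|G t| <= t.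
  by move=> t0; have := Glip 0 t; rewrite G0 !subr0 lexx; apply.
have cexpRN : continuous (fun t : R => expR (- t)).
  by move=> t; apply: continuous_comp; [exact: opp_continuous|exact: continuous_expR].
have cy : continuous y.
  move=> t; apply: cvgM; first exact: cexpRN.
  apply: cvgD; first exact: cvg_cst.
  by apply: cvgM; [exact: cvg_cst|exact: (primitive_continuous ui u1)].
have mg : measurable_fun (`[0, +oo[ : set (lebT R)) (g : lebT R -> R).
  apply: measurable_funD.
    by apply: continuous_measurable_lebT => t; apply: cvgN; exact: cy.
  apply: measurable_funM; last exact: mu.
  apply: continuous_measurable_lebT => t.
  by apply: cvgM; [exact: cvg_cst|exact: cexpRN].
have e01 (t : R) : 0 <= t -> 0 <= expR (- t) <= 1.
  by move=> t0; rewrite expR_ge0 expR_le1 oppr_le0.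
have yb (t : R) : 0 <= t -> `|y t| <= `|a| + `|b| * t.
  move=> t0; have /andP[e0 e1] := e01 _ t0.
  rewrite /y normrM (ger0_norm e0) (le_trans (ler_piMl _ e1))//.
  by rewrite (le_trans (ler_normD _ _))// lerD2l normrM ler_wpM2l// Gb.
have gi (t : R) : integrable_upto g t.
  apply: (@bounded_integrable_upto _ _ (`|a| + `|b| * t + `|b|)) => // s /andP[s0 st].
  have /andP[e0 e1] := e01 _ s0.
  rewrite (le_trans (ler_normD _ _))// normrN lerD//.
    by rewrite (le_trans (yb _ s0))// lerD2l ler_wpM2l.
  rewrite !normrM (ger0_norm e0) -mulrA -[leRHS]mulr1 ler_wpM2l//.
  by rewrite -[leRHS]mulr1 ler_pM// u1.
split; first exact: gi.
(* [B] bounds $|a + b\,G|$, hence also $|y|$, on $[0,T]$. *)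
pose B := `|a| + `|b| * T.
pose H t := y t - primitive g t.
suff HE : H T = H 0.
  move: HE; rewrite /H (primitive_le0 _ (lexx 0)) subr0 {2}/y oppr0 expR0 mul1r.
  by rewrite [primitive u 0]G0 mulr0 addr0 => <-; rewrite subrK.
(* The three summands of the constant belong, in this order, to the three terms into which
   [H t - H s] is split below. *)
apply: (@quadratic_increment_constant _ H (`|b| + B + (B + `|b| + `|b|)) T); last first.
  by rewrite T0 lexx.
move=> s t /andP[s0 st] tT.
have t0 := le_trans s0 st.
have yE r : y r - y s = b * expR (- r) * (G r - G s) +
    (expR (- r) - expR (- s)) * (a + b * G s) by rewrite /y /G; ring.
have aB : `|a + b * G s| <= B.
  rewrite (le_trans (ler_normD _ _))// lerD2l normrM ler_wpM2l//.
  by rewrite (le_trans (Gb _ s0))// (le_trans st).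
have B0 := le_trans (normr_ge0 _) aB.
have ylip r : s <= r <= t -> `|y r - y s| <= (B + `|b|) * (r - s).
  move=> /andP[sr rt]; have r0 := le_trans s0 sr.
  have /andP[e0 e1] := e01 _ r0.
  rewrite yE (le_trans (ler_normD _ _))// [leRHS]mulrDl [leRHS]addrC lerD//.
    rewrite !normrM (ger0_norm e0) -mulrA ler_wpM2l// -[leRHS]mul1r.
    by rewrite ler_pM// Glip// s0.
  by rewrite normrM mulrC ler_pM// expRN_lipschitz// s0.
(* Freezing the coefficient of [u] at time [s] removes the irregular part of [g]: what remains
   differs from [- y s] by $O(t-s)$ on $[s,t]$, even for discontinuous [u]. *)
pose f r := g r - b * expR (- s) * u r.
have fi r : integrable_upto f r by exact/integrable_uptoB/integrable_uptoZ.
have fs : `|primitive f t - primitive f s - (- y s) * (t - s)| <=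
    (B + `|b| + `|b|) * (t - s) * (t - s).
  apply: primitive_increment; rewrite ?s0// => r /andP[/ltW sr /ltW rt].
  have r0 := le_trans s0 sr.
  have -> : f r - - y s = - (y r - y s) + b * ((expR (- r) - expR (- s)) * u r).
    by rewrite /f /g; ring.
  rewrite (le_trans (ler_normD _ _))// normrN.
  apply: (@le_trans _ _ ((B + `|b| + `|b|) * (r - s))); last first.
    apply: ler_wpM2l; first exact: (addr_ge0 (addr_ge0 B0 (normr_ge0 _))).
    by rewrite lerD2r.
  rewrite [leRHS]mulrDl lerD ?ylip ?sr// normrM ler_wpM2l// normrM -[leRHS]mulr1.
  by rewrite ler_pM// ?u1// expRN_lipschitz// s0.
have fE r : primitive f r = primitive g r - b * expR (- s) * G r.
  by rewrite primitiveB ?primitiveZ//; exact: integrable_uptoZ.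
(* A product of two Lipschitz increments, the second-order remainder of the exponential times [y s],
   and the error made by freezing the coefficient: each is quadratic in [t - s]. *)
have -> : H t - H s = b * ((expR (- t) - expR (- s)) * (G t - G s)) +
    ((expR (- (t - s)) - 1 + (t - s)) * (expR (- s) * (a + b * G s))) -
    (primitive f t - primitive f s - (- y s) * (t - s)).
  have -> : expR (- t) = expR (- (t - s)) * expR (- s).
    by rewrite -expRD; congr expR; ring.
  rewrite !fE /H.
  have -> : y t = expR (- (t - s)) * expR (- s) * (a + b * G t).
    by rewrite /y -expRD; congr (expR _ * _); ring.
  have -> : y s = expR (- s) * (a + b * G s) by [].
  ring.
rewrite (le_trans (ler_normB _ _))// [leRHS]mulrDl lerD//; last first.
  by rewrite expr2 mulrA.
rewrite (le_trans (ler_normD _ _))// [leRHS]mulrDl lerD//.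
  rewrite normrM ler_wpM2l// normrM expr2 ler_pM ?expRN_lipschitz ?Glip ?s0//.
have /andP[e0 e1] := e01 _ s0.
rewrite normrM mulrC ler_pM//; last by rewrite expRN_increment// subr_ge0.
by rewrite normrM (ger0_norm e0) -[leRHS]mul1r ler_pM.
Qed.

(** The function $e^t g(t)$ has quadratic increments, hence is constant. The bound [M] turns the
    integral equation into a Lipschitz estimate for [g]. It is applied to the z-component and to the
    difference of two y-components. *)
Lemma relaxation_unique (R : realType) (g : R -> R) (a M T : R) :
  (forall t, 0 <= t <= T -> integrable_upto (fun s => - g s) t) ->
  (forall t, 0 <= t <= T -> g t = a + primitive (fun s => - g s) t) ->
  (forall t, 0 <= t <= T -> `|g t| <= M) ->
  forall t, 0 <= t <= T -> g t = a * expR (- t).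
Proof.
move=> gi gE gM.
have incr s t (k e : R) : 0 <= s <= t -> t <= T ->
    (forall r, s < r < t -> `|g r - k| <= e) ->
    `|g t - g s + k * (t - s)| <= e * (t - s).
  move=> /andP[s0 st] tT gk; have t0 := le_trans s0 st.
  rewrite gE ?t0// (gE s) ?s0 ?(le_trans st)//.
  have -> : a + primitive (fun s => - g s) t - (a + primitive (fun s => - g s) s) +
      k * (t - s) = primitive (fun s => - g s) t - primitive (fun s => - g s) s -
      (- k) * (t - s) by ring.
  apply: primitive_increment; first by rewrite s0.
    by apply: gi; rewrite t0.
  by move=> r /gk; rewrite -opprD normrN.
have g0 : g 0 = a \/ T < 0.
  have [T0|] := leP 0 T; [left|by right].
  by rewrite gE ?lexx// primitive_le0// addr0.
move=> t /andP[t0 tT]; case: g0 => [g0|]; last by have := le_trans t0 tT; lra.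
suff HE : expR t * g t = expR 0 * g 0.
  apply: (mulfI (lt0r_neq0 (expR_gt0 t))).
  by rewrite HE expR0 mul1r g0 mulrCA -expRD subrr expR0 mulr1.
have M0 : 0 <= M by rewrite (le_trans _ (gM t _))// t0.
(* $e^T$ bounds the common factor $e^t$; one [M] comes from the oscillation of [g] on $[s,t]$, the
   other from the remainder of the exponential. *)
apply: (@quadratic_increment_constant _ (fun t => expR t * g t)
  (expR T * (M + M)) T); last first.
  by rewrite t0.
move=> {t t0 tT} s t /andP[s0 st] tT; have t0 := le_trans s0 st.
have sT := le_trans st tT.
have h0 : 0 <= t - s by rewrite subr_ge0.
have glip r : s <= r <= t -> `|g r - g s| <= M * (t - s).
  move=> /andP[sr rt]; have rT := le_trans rt tT.
  have := incr s r 0 M; rewrite s0 sr rT => /(_ isT isT); rewrite mul0r addr0.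
  move=> /(_ _)/le_trans; apply; last by rewrite ler_wpM2l// lerD2r.
  move=> x /andP[sx xr]; rewrite subr0 gM// (le_trans s0 (ltW sx)).
  by rewrite (le_trans (ltW xr)).
have -> : expR t * g t - expR s * g s = expR t * ((g t - g s + g s * (t - s)) -
    g s * (expR (- (t - s)) - 1 + (t - s))).
  have -> : expR s = expR t * expR (- (t - s)) by rewrite -expRD; congr expR; ring.
  ring.
rewrite normrM (ger0_norm (expR_ge0 _)) -mulrA ler_pM//.
  by rewrite ler_expR.
rewrite (le_trans (ler_normB _ _))// mulrDl lerD//.
  rewrite expr2 mulrA; apply: incr; rewrite ?s0// => r /andP[/ltW sr /ltW rt].
  by rewrite glip ?sr.
by rewrite normrM ler_pM ?gM ?s0 ?expRN_increment.
Qed.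

(** * Primitives of step functions *)

(** [symbol_at] for an explicit word; on negative reals truncation gives 0, so the value is
    [w 0]. *)
Definition step_fun (R : realType) (w : nat -> R) (s : R) : R :=
  w (Num.trunc s).

Lemma measurable_step_fun (R : realType) (w : nat -> R) :
  measurable_fun (setT : set (measurableTypeR R)) (step_fun w).
Proof.
move=> _ B mB; rewrite setTI.
have -> : step_fun w @^-1` B =
    \bigcup_(n in [set n | B (w n)]) [set s : R | Num.trunc s = n].
  apply/seteqP; split => [s Bs|s [n /= Bn sn]]; first by exists (Num.trunc s).
  by rewrite /step_fun /= sn.
apply: bigcup_measurable => -[|n] _.
  (* The fibre over 0 contains all negative reals as well. *)
  rewrite (_ : [set _ | _] = [set` `]-oo, 1[%R]); first exact: measurable_itv.
  apply/seteqP; split => s /=; rewrite in_itv/=.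
    by move=> s0; have := truncnS_gt s; rewrite s0.
  by move=> s1; apply/eqP; rewrite -leqn0 truncn_le_nat.
rewrite (_ : [set _ | _] = [set` `[n.+1%:R : R, n.+2%:R[%R]); first exact: measurable_itv.
apply/seteqP; split => s /=; rewrite in_itv/=.
  move=> sn; have s0 : 0 <= s.
    rewrite leNgt; apply/negP => s0; have : (Num.trunc s <= 0)%N.
      by rewrite truncn_le_nat (lt_trans s0).
    by rewrite sn.
  by have := truncn_itv s0; rewrite sn.
by move=> /truncn_def.
Qed.

(** Shifts occur because a trajectory starting at height [z] reads the word from time [- ln z]
    on. *)
Lemma measurable_step_fun_shift (R : realType) (w : nat -> R) (r : R) :
  measurable_fun (`[0, +oo[ : set (lebT R)) ((fun s => step_fun w (s + r)) : lebT R -> R).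
Proof.
apply: borel_measurable_fun_lebT; first exact: measurable_itv_lebT.
have -> : (fun s => step_fun w (s + r)) = step_fun w \o (fun s => s + r) by [].
apply: measurableT_comp; first exact: measurable_step_fun.
by apply: continuous_measurable_fun => s; apply: cvgD; [exact: cvg_id|exact: cvg_cst].
Qed.

Lemma Sigma_norm (R : realType) (w : nat -> R) j : Sigma R w -> `|w j| = 1.
Proof. by move=> /(_ j)[]->; rewrite ?normrN normr1. Qed.

Lemma integrable_step_fun_shift (R : realType) (w : nat -> R) (r t : R) :
  Sigma R w -> integrable_upto (fun s => step_fun w (s + r)) t.
Proof.
move=> Sw; apply: (@bounded_integrable_upto _ _ 1).
  exact: measurable_step_fun_shift.
by move=> s _; rewrite /step_fun Sigma_norm.
Qed.

Lemma step_fun_piece (R : realType) (w : nat -> R) (r s t : R) (j : nat) :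
  Sigma R w -> 0 <= s <= t -> j%:R <= s + r -> t + r <= j.+1%:R ->
  primitive (fun s => step_fun w (s + r)) t - primitive (fun s => step_fun w (s + r)) s
  = w j * (t - s).
Proof.
move=> Sw st js tj; apply/eqP; rewrite -subr_eq0 -normr_le0.
rewrite -[leRHS](mul0r (t - s)); apply: primitive_increment => //.
  exact: integrable_step_fun_shift.
move=> x /andP[sx xt]; rewrite /step_fun (@truncn_def _ _ j) ?subrr ?normr0//.
by rewrite (le_trans js) ?lerD2r ?ltW//= (lt_le_trans _ tj)// ltrD2r.
Qed.

Lemma integrable_step_fun (R : realType) (w : nat -> R) (t : R) :
  Sigma R w -> integrable_upto (step_fun w) t.
Proof.
move=> Sw; apply: eq_integrable_upto (integrable_step_fun_shift 0 t Sw) => s _.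
by rewrite addr0.
Qed.

Lemma step_fun_piece0 (R : realType) (w : nat -> R) (s t : R) (j : nat) :
  Sigma R w -> j%:R <= s -> s <= t -> t <= j.+1%:R ->
  primitive (step_fun w) t - primitive (step_fun w) s = w j * (t - s).
Proof.
move=> Sw js st tj; have s0 : 0 <= s by rewrite (le_trans _ js).
have E x : primitive (step_fun w) x = primitive (fun s => step_fun w (s + 0)) x.
  by apply: eq_primitive => y _; rewrite addr0.
by rewrite !E; apply: step_fun_piece; rewrite ?s0 ?addr0.
Qed.

Lemma piecewise_constant (R : realType) (H : R -> R) (n : nat) :
  (forall j s t, (j < n)%N -> j%:R <= s -> s <= t -> t <= j.+1%:R -> H t = H s) ->
  forall t, 0 <= t <= n%:R -> H t = H 0.
Proof.
elim: n => [_ t|n IH Hj t /andP[t0 tn]].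
  by rewrite -eq_le => /eqP <-.
have Hn x : 0 <= x <= n%:R -> H x = H 0.
  by apply: IH => j ? ? jn; apply: Hj; rewrite ltnS ltnW.
have [tn'|/ltW tn'] := leP t n%:R; first by apply: Hn; rewrite t0.
by rewrite (Hj n n%:R)// Hn// lexx andbT.
Qed.

(** On each unit interval below [n] both primitives have the same slope, so their difference keeps
    its value at 0. *)
Lemma primitive_step_fun_eq (R : realType) (w w' : nat -> R) (n : nat) (t : R) :
  Sigma R w -> Sigma R w' -> (forall j, (j < n)%N -> w j = w' j) -> t <= n%:R ->
  primitive (step_fun w) t = primitive (step_fun w') t.
Proof.
move=> Sw Sw' ww' tn; have [t0|/ltW t0] := leP 0 t; last by rewrite !primitive_le0.
apply/eqP; rewrite -subr_eq0; apply/eqP.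
pose H t := primitive (step_fun w) t - primitive (step_fun w') t.
rewrite -[LHS]/(H t) (@piecewise_constant _ H n) ?t0 {t t0 tn}//.
  by rewrite /H !primitive_le0// subrr.
move=> j s t jn js st tj; rewrite /H.
have := step_fun_piece0 Sw js st tj; have := step_fun_piece0 Sw' js st tj.
rewrite ww'//; lra.
Qed.

Lemma primitive_step_fun_shift (R : realType) (w : nat -> R) (r t : R) :
  Sigma R w -> 0 <= r -> 0 <= t ->
  primitive (fun s => step_fun w (s + r)) t =
  primitive (step_fun w) (t + r) - primitive (step_fun w) r.
Proof.
move=> Sw r0 t0; set P := primitive (fun s => _).
(* The maximum makes [H] constant on $[0,r]$, so that the pieces may be cut at integers although [r]
   need not be one. *)
pose H x := P (Num.max x r - r) - primitive (step_fun w) (Num.max x r).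
have HE : H (t + r) = H 0.
  apply: (@piecewise_constant _ _ (Num.trunc (t + r)).+1); last first.
    by rewrite addr_ge0//= ltW// truncnS_gt.
  move=> j x y _ jx xy yj.
  have [yr|/ltW ry] := leP y r.
    by rewrite /H !max_r// (le_trans xy).
  set x' := Num.max x r.
  have x'y : x' <= y by rewrite ge_max xy.
  have rx' : r <= x' by rewrite le_max lexx orbT.
  have jx' : j%:R <= x' by rewrite le_max jx.
  rewrite /H (max_l ry) -/x'; apply/eqP; rewrite -subr_eq0; apply/eqP.
  have := @step_fun_piece _ w r (x' - r) (y - r) j Sw.
  rewrite !subrK subr_ge0 rx' lerD2r x'y => /(_ isT jx' yj); rewrite -/P => E1.
  have E2 := step_fun_piece0 Sw jx' x'y yj.
  have : w j * (y - r - (x' - r)) = w j * (y - x') by ring.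
  by move: E1 E2; set a := primitive _ y; set b := primitive _ x'; lra.
have rtr : r <= t + r by rewrite lerDr.
move: HE; rewrite /H (max_l rtr) (max_r r0) addrK subrr.
rewrite [P 0]primitive_le0//; lra.
Qed.

(** * The coding map *)

Definition coding_term (R : realType) (w : nat -> R) (j : nat) : R :=
  (w j + 1) / 3 ^+ j.+1.

Lemma Sigma_shift (R : realType) (w : nat -> R) : Sigma R w -> Sigma R (w \o S).
Proof. by move=> Sw j; exact: Sw. Qed.

Lemma coding_term_ge0 (R : realType) (w : nat -> R) j : Sigma R w ->
  0 <= coding_term w j <= 2 / 3 ^+ j.+1.
Proof.
move=> Sw; have p3 : 0 <= (3 ^+ j.+1)^-1 :> R by rewrite invr_ge0 exprn_ge0.
by rewrite /coding_term; case: (Sw j) => ->; apply/andP; split; nra.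
Qed.

Lemma coding_series_le1 (R : realType) (w : nat -> R) n : Sigma R w ->
  series (coding_term w) n <= 1.
Proof.
(* The sharper bound $1-3^{-n}$ is the one that passes through the induction. *)
move=> Sw; apply: (@le_trans _ _ (1 - (3 ^+ n)^-1)); last first.
  by rewrite gerBl invr_ge0 exprn_ge0.
rewrite seriesEnat /=; elim: n => [|n IH]; first by rewrite big_nil expr0 invr1 subrr.
rewrite big_nat_recr//= (le_trans (lerD IH (proj2 (andP (coding_term_ge0 n Sw)))))//.
have p3 : (3 ^+ n : R) != 0 by rewrite expf_neq0.
by rewrite exprS le_eqVlt; apply/orP; left; apply/eqP; field.
Qed.

Lemma is_cvg_coding (R : realType) (w : nat -> R) : Sigma R w ->
  cvgn (series (coding_term w)).
Proof.
move=> Sw; apply: nondecreasing_is_cvgn.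
  apply: nondecreasing_series => n _ _.
  by have /andP[] := coding_term_ge0 n Sw.
exists 1 => _ [n _ <-]; exact: coding_series_le1.
Qed.

Lemma coding_itv (R : realType) (w : nat -> R) : Sigma R w ->
  0 <= coding w <= 1.
Proof.
move=> Sw; apply/andP; split.
  apply: limr_ge; first exact: is_cvg_coding.
  apply: nearW => n; rewrite seriesEnat; apply: sumr_ge0 => j _.
  by have /andP[] := coding_term_ge0 j Sw.
apply: limr_le; first exact: is_cvg_coding.
by apply: nearW => n; exact: coding_series_le1.
Qed.

(** Self-similarity of the Cantor set: injectivity and continuity of the coding both follow by
    peeling off one symbol at a time. *)
Lemma coding_rec (R : realType) (w : nat -> R) : Sigma R w ->
  coding w = (w 0 + 1) / 3 + coding (w \o S) / 3.
Proof.
move=> Sw; apply/cvg_lim => //; rewrite -(cvg_shiftS (series (coding_term w))).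
have -> : (fun n => series (coding_term w) n.+1) =
    (fun n => (w 0 + 1) / 3 + series (coding_term (w \o S)) n / 3).
  apply/funext => n; rewrite !seriesEnat/= big_nat_recl// {1}/coding_term expr1.
  congr (_ + _); rewrite mulr_suml; apply: eq_bigr => j _.
  by rewrite /coding_term/= [in LHS]exprSr invfM mulrA.
apply: cvgD; first exact: cvg_cst.
by apply: cvgM; [exact/is_cvg_coding/Sigma_shift|exact: cvg_cst].
Qed.

(** The tail has its code in $[0,1]$, so a first symbol -1 puts the code in $[0,1/3]$ and a first
    symbol 1 in $[2/3,1]$, which are disjoint. *)
Lemma coding_head (R : realType) (w w' : nat -> R) : Sigma R w -> Sigma R w' ->
  coding w = coding w' -> w 0 = w' 0 /\ coding (w \o S) = coding (w' \o S).
Proof.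
move=> Sw Sw'; rewrite (coding_rec Sw) (coding_rec Sw').
have := coding_itv (Sigma_shift Sw); have := coding_itv (Sigma_shift Sw').
case: (Sw 0) => ->; case: (Sw' 0) => ->; lra.
Qed.

Lemma coding_inj (R : realType) : {in Sigma R &, injective (@coding R)}.
Proof.
move=> w w' /set_mem Sw /set_mem Sw' ww'; apply/funext => n.
elim: n w w' Sw Sw' ww' => [|n IH] w w' Sw Sw' /(coding_head Sw Sw')[]//.
by move=> _ /IH; apply; exact: Sigma_shift.
Qed.

Lemma symbolsK (R : realType) (w : nat -> R) : Sigma R w ->
  symbols (coding w) = w.
Proof.
move=> Sw; rewrite /symbols; apply: pinvKV; last exact: mem_set.
exact: coding_inj.
Qed.

Lemma coding_close (R : realType) (w w' : nat -> R) (n : nat) :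
  Sigma R w -> Sigma R w' -> (forall j, (j < n)%N -> w j = w' j) ->
  `|coding w - coding w'| <= (3 ^+ n)^-1.
Proof.
elim: n w w' => [|n IH] w w' Sw Sw' ww'.
  rewrite expr0 invr1 ler_norml.
  by have := coding_itv Sw; have := coding_itv Sw'; lra.
have {}IH := IH _ _ (Sigma_shift Sw) (Sigma_shift Sw') (fun j jn => ww' j.+1 jn).
rewrite (coding_rec Sw) (coding_rec Sw') ww'// opprD addrACA subrr add0r.
rewrite -mulrBl normrM exprSr invfM.
by rewrite (ger0_norm (_ : 0 <= 3^-1))// ler_wpM2r.
Qed.

(** Boolean words identify [Sigma] with the points of [cantor_space], whose compactness is
    transported to [K] and [Q]; they also make finite words easy to count. *)
Definition sign_word (R : realType) (b : nat -> bool) (j : nat) : R :=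
  if b j then 1 else -1.

Lemma Sigma_sign_word (R : realType) (b : nat -> bool) : Sigma R (sign_word R b).
Proof. by move=> j; rewrite /sign_word; case: (b j); [right|left]. Qed.

Lemma sign_wordP (R : realType) (w : nat -> R) : Sigma R w ->
  w = sign_word R (fun j => w j == 1).
Proof.
move=> Sw; apply/funext => j; rewrite /sign_word; have [//|] := eqVneq (w j) 1.
by case: (Sw j) => ->; rewrite ?eqxx.
Qed.

(** * Compactness of K and Q *)

(** Each coordinate is continuous with values in a discrete space, hence locally constant, and only
    finitely many coordinates are involved. *)
Lemma near_agree (T : topologicalType) (f : T -> cantor_space) (x : T) (n : nat) :
  continuous f -> \forall y \near x, forall j, (j < n)%N -> f y j = f x j.
Proof.
move=> cf.
have coord j : \forall y \near x, f y j = f x j.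
  have cj : {for x, continuous (fun y => (f y j : bool))}.
    by apply: (@continuous_comp _ _ _ f (fun b : cantor_space => b j));
      [exact: cf|exact: (@proj_continuous nat (fun=> bool))].
  by apply: (cj [set b | b = f x j]); exact: discrete_set1.
elim: n => [|n IH]; first by apply: nearW.
near=> y => j; rewrite ltnS leq_eqVlt => /predU1P[->|]; last first.
  by move: j; near: y.
by near: y; exact: coord.
Unshelve. all: by end_near. Qed.

Lemma continuous_coding (R : realType) :
  continuous (fun b : cantor_space => coding (sign_word R b)).
Proof.
move=> b; apply/cvgrPdist_le => e e0.
have [n ne] : exists n, (3 ^+ n)^-1 <= e.
  exists (Num.trunc e^-1).+1; rewrite -[leRHS]invrK lef_pV2 ?posrE ?invr_gt0 ?exprn_gt0//.
  apply: ltW; apply: (lt_le_trans (truncnS_gt _)).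
  by rewrite -natrX ler_nat ltnW// ltn_expl.
near=> b'; rewrite (le_trans _ ne)//; apply: coding_close; try exact: Sigma_sign_word.
move=> j jn; rewrite /sign_word; suff -> : b' j = b j by [].
move: j jn; near: b'.
by apply: (@near_agree _ (fun x : cantor_space => x)) => x; exact: cvg_id.
Unshelve. all: by end_near. Qed.

Lemma matching_FE (R : realType) (z : R) (w : nat -> R) : Sigma R w ->
  matching_F z (coding w) = if 0 < z then z * primitive (step_fun w) (- ln z) else 0.
Proof. by move=> Sw; rewrite /matching_F /matching_q /symbol_at symbolsK. Qed.

Lemma primitive_step_fun_le (R : realType) (w : nat -> R) (t : R) :
  Sigma R w -> 0 <= t -> `|primitive (step_fun w) t| <= t.
Proof.
move=> Sw t0; have := @primitive_lipschitz R (step_fun w) 1 0 t.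
rewrite lexx t0 (primitive_le0 _ (lexx 0)) !subr0 mul1r; apply=> //.
  exact: integrable_step_fun.
by move=> r _; rewrite /step_fun Sigma_norm.
Qed.

Lemma continuous_primitive_step_fun (R : realType) (w : nat -> R) :
  Sigma R w -> continuous (primitive (step_fun w)).
Proof.
move=> Sw; apply: (@primitive_continuous _ _ 1) => [t|r _].
  exact: integrable_step_fun.
by rewrite /step_fun Sigma_norm.
Qed.

(** Gives continuity at [z = 0] uniformly in the word: $|F| \le z(-\log z)$ for $z<1$, and $-\log z
    = 2\log z^{-1/2} \le 2 z^{-1/2}$. *)
Lemma matching_F_sqrt (R : realType) (z : R) (w : nat -> R) : Sigma R w ->
  `|matching_F z (coding w)| <= 2 * Num.sqrt z.
Proof.
move=> Sw; rewrite matching_FE//; have [z0|_] := ltP 0 z; last first.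
  by rewrite normr0 mulr_ge0// sqrtr_ge0.
have [z1|z1] := leP 1 z.
  by rewrite primitive_le0 ?mulr0 ?normr0 ?mulr_ge0 ?sqrtr_ge0// oppr_le0 ln_ge0.
have s0 : 0 < Num.sqrt z by rewrite sqrtr_gt0.
have zE : z = Num.sqrt z ^+ 2 by rewrite sqr_sqrtr// ltW.
have lnz : - ln z <= 2 / Num.sqrt z.
  rewrite [in leLHS]zE lnXn// -mulNrn -lnV// mulr_natl; apply: ltW.
  by rewrite ltr_pMn2r// ln_sublinear// invr_gt0.
have l0 : 0 <= - ln z by rewrite oppr_ge0 ln_le0// ltW.
rewrite normrM gtr0_norm// (le_trans (ler_wpM2l (ltW z0) (primitive_step_fun_le Sw l0)))//.
rewrite (le_trans (ler_wpM2l (ltW z0) lnz))// {1}zE.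
by rewrite le_eqVlt; apply/orP; left; apply/eqP; field; rewrite gt_eqF.
Qed.

Lemma continuous_matching_F (R : realType) :
  continuous (fun p : R * cantor_space => matching_F p.1 (coding (sign_word R p.2))).
Proof.
move=> [z0 b0]; rewrite /prop_for/= /continuous_at/=.
have [z00|z00] := leP z0 0.
  have -> : matching_F z0 (coding (sign_word R b0)) = 0.
    by rewrite /matching_F ltNge z00.
  apply/cvgrPdist_le => e e0; near=> p.
  rewrite sub0r normrN (le_trans (matching_F_sqrt _ (Sigma_sign_word R p.2)))//.
  have -> : e = 2 * Num.sqrt ((e / 2) ^+ 2).
    by rewrite sqrtr_sqr gtr0_norm ?divr_gt0//; field.
  rewrite ler_wpM2l//.
  rewrite ler_wsqrtr//.
  near: p; apply: (@cvgr_le _ _ _ _ (fun p : R * cantor_space => p.1) z0).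
    exact: cvg_fst.
  by rewrite (le_lt_trans z00)// exprn_gt0// divr_gt0.
(* [N] exceeds [- ln z0], hence also [- ln p.1] near the base point. Words close to [b0] share its
   first [N] symbols, so there the function equals the one with the word fixed to [b0]. *)
pose N := (Num.trunc (1 - ln z0)).+1.
have cz : (- ln p.1) @[p --> ((z0, b0) : R * cantor_space)] --> - ln z0.
  apply: cvgN; apply: (@cvg_comp _ _ _ (fun p : R * cantor_space => p.1) (@ln R) _ (nbhs z0)).
    exact: cvg_fst.
  exact: continuous_ln.
rewrite [in X in _ --> X]matching_FE ?z00; last exact: Sigma_sign_word.
have cG : p.1 * primitive (step_fun (sign_word R b0)) (- ln p.1)
    @[p --> ((z0, b0) : R * cantor_space)] -->
    z0 * primitive (step_fun (sign_word R b0)) (- ln z0).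
  apply: cvgM; first exact: cvg_fst.
  apply: (@cvg_comp _ _ _ _ (primitive (step_fun (sign_word R b0))) _ _ _ cz).
  by apply: continuous_primitive_step_fun; exact: Sigma_sign_word.
apply: cvg_trans cG; apply: near_eq_cvg; near=> p.
have p0 : 0 < p.1.
  near: p; apply: (@cvgr_gt _ _ _ _ (fun p : R * cantor_space => p.1) z0) => //.
  exact: cvg_fst.
rewrite matching_FE ?p0; last exact: Sigma_sign_word.
congr (_ * _); apply: (@primitive_step_fun_eq _ _ _ N); try exact: Sigma_sign_word.
  move=> j jn; rewrite /sign_word; suff -> : p.2 j = b0 j by [].
  move: j jn; near: p.
  by apply: (@near_agree _ (fun p : R * cantor_space => p.2) (z0, b0)) => x; exact: cvg_snd.
near: p; apply: (cvgr_le _ cz).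
by rewrite (lt_trans _ (truncnS_gt _))// ltrDr.
Unshelve. all: by end_near. Qed.

Lemma continuous_vec3 (R : realType) (T : topologicalType) (f g h : T -> R) :
  continuous f -> continuous g -> continuous h ->
  continuous (fun x => vec3 (f x) (g x) (h x)).
Proof.
move=> cf cg ch.
have -> : (fun x => vec3 (f x) (g x) (h x)) =
    (fun x => f x *: delta_mx 0 0 + g x *: delta_mx 0 1 + h x *: delta_mx 0 2).
  apply/funext => x; apply/rowP => i; rewrite !mxE/=.
  by case: i => -[|[|[|]]]//= ?; rewrite ?mulr1 ?mulr0 ?addr0 ?add0r.
move=> x.
exact: (cvgD (cvgD (cvgZr_tmp (cf x)) (cvgZr_tmp (cg x))) (cvgZr_tmp (ch x))).
Qed.

Lemma compact_Kset (R : realType) : compact (Kset R).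
Proof.
have -> : Kset R = (fun b : cantor_space => vec3 1 (coding (sign_word R b)) 0) @` setT.
  apply/seteqP; split => [_ [_ [w Sw <-] <-]|_ [b _ <-]].
    exists (fun j => w j == 1) => //.
    by rewrite -(sign_wordP Sw).
  exists (coding (sign_word R b)) => //.
  by exists (sign_word R b) => //; exact: Sigma_sign_word.
apply: continuous_compact; last exact: cantor_space_compact.
apply: continuous_subspaceT; apply: continuous_vec3.
- by move=> ?; exact: cvg_cst.
- exact: continuous_coding.
- by move=> ?; exact: cvg_cst.
Qed.

(** [Q] is a continuous image of the product of the unit interval and the Cantor space. *)
Lemma compact_Qset (R : realType) : compact (Qset R).
Proof.
pose G (p : R * cantor_space) := vec3 p.1 (coding (sign_word R p.2))
  (matching_F p.1 (coding (sign_word R p.2))).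
have -> : Qset R = G @` (`[0, 1] `*` setT).
  apply/seteqP; split => [_ [z z01 [_ [w Sw <-]] <-]|_ [[z b] [/= z01 _] <-]].
    exists (z, (fun j => w j == 1) : cantor_space); first by split.
    by rewrite /G/= -(sign_wordP Sw).
  exists z => //; exists (coding (sign_word R b)) => //.
  by exists (sign_word R b) => //; exact: Sigma_sign_word.
apply: continuous_compact.
  apply: continuous_subspaceT; apply: continuous_vec3.
  - by move=> p; exact: cvg_fst.
  - move=> p; apply: (@continuous_comp _ _ _ (fun p : R * cantor_space => p.2)
      (fun b : cantor_space => coding (sign_word R b))); first exact: cvg_snd.
    exact: continuous_coding.
  - exact: continuous_matching_F.
apply: compact_setX; first exact: segment_compact.
exact: cantor_space_compact.
Qed.

(** * Controls and trajectories *)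

Lemma controlP (R : realType) (u : control (Urange R)) :
  measurable_fun (`[0, +oo[ : set (lebT R)) (u : lebT R -> R) /\
  forall t, 0 <= t -> `|u t| <= 1.
Proof.
have [mu u1] := set_valP (repr u : admissible (Urange R)).
by split=> // t /u1; rewrite /Urange /= in_itv/= ler_norml.
Qed.

(** The chosen representative of the class of [v] agrees with [v] only almost everywhere on the
    half-line; its primitives are the same, and trajectories depend on the control through these
    alone. *)
Lemma exists_control (R : realType) (v : R -> R) :
  measurable_fun (`[0, +oo[ : set (lebT R)) (v : lebT R -> R) ->
  (forall t, 0 <= t -> `|v t| <= 1) ->
  exists u : control (Urange R), forall t, primitive u t = primitive v t.
Proof.
move=> mv v1.
have av : admissible (Urange R) v.
  by split=> // t /v1; rewrite /Urange/= in_itv/= ler_norml.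
pose x : admissible (Urange R) := SigSub (mem_set av).
pose u : control (Urange R) := (\pi_(control (Urange R)) x)%qT.
exists u => t.
have : repr u = x %[mod_eq (ae_equal_equiv (Urange R))]%qT by exact: reprK.
move=> /eqmodP/asboolP ux.
have sub0t : `[0, t] `<=` (`[0, +oo[ : set (lebT R)).
  by move=> s /=; rewrite !in_itv/= => /andP[->].
have mS f : measurable_fun (`[0, +oo[ : set (lebT R)) (f : lebT R -> R) ->
    measurable_fun (`[0, t] : set (lebT R)) (fun s : lebT R => (f s)%:E).
  move=> mf; apply/measurable_EFinP; apply: measurable_funS mf => //.
  exact: measurable_itv_lebT.
rewrite /primitive /Rintegral; congr fine; apply: ae_eq_integral.
- exact: measurable_itv_lebT.
- by apply: mS; exact: (controlP u).1.
- exact: mS.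
have ae_filter := ae_filter_ringOfSetsType (lambda R).
apply: filterS ux => s us /=; rewrite in_itv/= => /andP[s0 _].
by congr EFin; exact: us.
Qed.

Lemma caratheodory_solution_field (R : realType) (u : control (Urange R)) (z c y : R) :
  caratheodory_solution (field R) (vec3 z c y) u
    (fun t => vec3 (z * expR (- t)) c (expR (- t) * (y + z * primitive u t))).
Proof.
have [mu u1] := controlP u.
have [i0 i1 i2] : [/\ forall t, 0 <= t -> integrable_upto (fun s => - (z * expR (- s))) t /\
      z * expR (- t) = z + primitive (fun s => - (z * expR (- s))) t,
    forall t, integrable_upto (fun _ : R => 0) t /\ primitive (fun _ : R => 0) t = 0 &
    forall t, 0 <= t -> let g := fun s =>
      - (expR (- s) * (y + z * primitive u s)) + z * expR (- s) * u s in
      integrable_upto g t /\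
      expR (- t) * (y + z * primitive u t) = y + primitive g t].
  split.
  (* With [b = 0] the equation is $z' = -z$; the y-component below is the case [a = y], [b = z]. *)
  - move=> t t0; have := relaxation_solution z 0 mu u1 t0.
    set g := (g in integrable_upto g t /\ _).
    have gE s : g s = - (z * expR (- s)).
      by rewrite /g !mul0r !addr0 mulrC.
    rewrite mul0r addr0 mulrC => -[gi ->]; split.
      by apply: eq_integrable_upto gi => s _; exact: gE.
    by congr (_ + _); apply: eq_primitive => s _; exact: gE.
  - move=> t; split.
      apply: (@bounded_integrable_upto _ _ 0) => [|s _]; last by rewrite normr0.
      exact: measurable_cst.
    by rewrite /primitive Rintegral_cst ?mul0r//; exact: measurable_itv_lebT.
  - by move=> t t0 g; have := relaxation_solution y z mu u1 t0.
move=> t t0 i; rewrite -/(primitive _ t) -/(integrable_upto _ t).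
case: i => -[|[|[|]]]//= lti; rewrite !mxE/=.
- have [gi gE] := i0 _ t0; rewrite {}gE; split.
    by apply: eq_integrable_upto gi => s _; rewrite !mxE.
  by congr (_ + _); apply: eq_primitive => s _; rewrite !mxE.
- have [gi gE] := i1 t; split.
    by apply: eq_integrable_upto gi => s _; rewrite !mxE.
  rewrite -[LHS]addr0 -[X in _ + X]gE.
  by congr (_ + _); apply: eq_primitive => s _; rewrite !mxE.
- have [gi gE] := i2 _ t0; rewrite {}gE; split.
    by apply: eq_integrable_upto gi => s _; rewrite !mxE/=.
  by congr (_ + _); apply: eq_primitive => s _; rewrite !mxE/=.
Qed.

(** * Weak invariance and spanning sets *)

Lemma matching_F_expRN (R : realType) (w : nat -> R) (z t : R) : Sigma R w -> 0 < z ->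
  matching_F (z * expR (- t)) (coding w) =
  z * expR (- t) * primitive (step_fun w) (t - ln z).
Proof.
move=> Sw z0; rewrite matching_FE// mulr_gt0 ?expR_gt0//.
by rewrite lnM ?posrE ?expR_gt0// expRK opprD opprK addrC.
Qed.

Lemma Kset_sub_Qset (R : realType) : Kset R `<=` Qset R.
Proof.
move=> _ [_ [w Sw <-] <-]; exists 1; first by rewrite /= in_itv/= ler01 lexx.
exists (coding w); first by exists w.
by rewrite matching_FE// ltr01 primitive_le0 ?mulr0// ln1 oppr0.
Qed.

Lemma weakly_invariant_Qset (R : realType) :
  weakly_invariant (Urange R) (field R) (Qset R).
Proof.
move=> _ [z /= z01 [_ [w Sw <-] <-]]; move: z01; rewrite in_itv/= => /andP[z0 z1].
have step1 s : `|step_fun w s| <= 1 by rewrite /step_fun Sigma_norm.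
(* The control replays the word of [c] from time [- ln z], at which the matching function is
   evaluated at height [z]. *)
have [u uE] := exists_control (measurable_step_fun_shift w (- ln z)) (fun t _ => step1 _).
exists u; exists (fun t => vec3 (z * expR (- t)) (coding w)
    (expR (- t) * (matching_F z (coding w) + z * primitive u t))).
  exact: caratheodory_solution_field.
move=> t; rewrite /= in_itv/= andbT => t0.
exists (z * expR (- t)).
  rewrite /= in_itv/= mulr_ge0 ?expR_ge0//= mulr_ile1 ?expR_ge0//.
  by rewrite expR_le1 oppr_le0.
exists (coding w); first by exists w.
(* At [z = 0] both z and y stay 0 under any control. *)
congr vec3; move: z0; rewrite le_eqVlt => /predU1P[<-|z0].
  by rewrite /matching_F !mul0r ltxx addr0 mulr0.
rewrite matching_F_expRN// uE primitive_step_fun_shift//; last first.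
  by rewrite oppr_ge0 ln_le0.
by rewrite matching_FE// z0; ring.
Qed.

Lemma exists_word_control (R : realType) (w : nat -> R) : Sigma R w ->
  exists u : control (Urange R), forall t, primitive u t = primitive (step_fun w) t.
Proof.
move=> Sw; have step1 s : `|step_fun w s| <= 1 by rewrite /step_fun Sigma_norm.
have [u uE] := exists_control (measurable_step_fun_shift w 0) (fun t _ => step1 _).
by exists u => t; rewrite uE; apply: eq_primitive => s _; rewrite addr0.
Qed.

Definition word_control (R : realType) (b : nat -> bool) : control (Urange R) :=
  projT1 (cid (exists_word_control (Sigma_sign_word R b))).

Lemma primitive_word_control (R : realType) (b : nat -> bool) (t : R) :
  primitive (word_control R b) t = primitive (step_fun (sign_word R b)) t.
Proof. by rewrite /word_control; case: cid. Qed.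

(** Padding with [false] makes all later symbols -1. *)
Definition extend_word (n : nat) (b : {ffun 'I_n -> bool}) (j : nat) : bool :=
  if insub j is Some i then b i else false.

Lemma extend_wordE (n : nat) (b : nat -> bool) (j : nat) : (j < n)%N ->
  extend_word [ffun i : 'I_n => b i] j = b j.
Proof. by move=> jn; rewrite /extend_word insubT ffunE. Qed.

(** This family gives the upper bound for both entropies: [n] is about [T] in the strict case, and
    depends on [eps] only in the ordinary one. *)
Definition word_controls (R : realType) (n : nat) : {fset control (Urange R)} :=
  [fset word_control R (extend_word b) | b : {ffun 'I_n -> bool} in predT]%fset.

Lemma card_word_controls (R : realType) (n : nat) :
  (#|` word_controls R n| <= 2 ^ n)%N.
Proof.
apply: (leq_trans (leq_imfset_card _ _ _)) => /=.
by rewrite -cardE card_ffun card_bool card_ord.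
Qed.

Lemma word_controlsP (R : realType) (n : nat) (w : nat -> R) : Sigma R w ->
  exists2 u, u \in word_controls R n & exists2 b, u = word_control R b &
    forall j, (j < n)%N -> sign_word R b j = w j.
Proof.
move=> Sw; pose b := [ffun i : 'I_n => w i == 1].
exists (word_control R (extend_word b)).
  by apply/imfsetP; exists b.
exists (extend_word b) => // j jn.
by rewrite [in RHS](sign_wordP Sw) /sign_word (extend_wordE (fun j => w j == 1) jn).
Qed.

Lemma caratheodory_solution_Kset (R : realType) (u : control (Urange R)) (c : R) :
  caratheodory_solution (field R) (vec3 1 c 0) u
    (fun t => vec3 (expR (- t)) c (expR (- t) * primitive u t)).
Proof.
have := caratheodory_solution_field u 1 c 0.
congr caratheodory_solution; apply/funext => t.
by rewrite mul1r add0r mul1r.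
Qed.

Lemma Qset_expRN (R : realType) (w : nat -> R) (t : R) : Sigma R w -> 0 <= t ->
  Qset R (vec3 (expR (- t)) (coding w) (expR (- t) * primitive (step_fun w) t)).
Proof.
move=> Sw t0; exists (expR (- t)).
  by rewrite /= in_itv/= expR_ge0 expR_le1 oppr_le0.
exists (coding w); first by exists w.
by have := matching_F_expRN t Sw ltr01; rewrite !mul1r ln1 subr0 => ->.
Qed.

Lemma spanning_strict (R : realType) (n : nat) (T : R) : T <= n%:R ->
  spanning (field R) T (Kset R) (Qset R) (word_controls R n).
Proof.
move=> Tn _ [_ [w Sw <-] <-]; have [u uS [b uE bw]] := word_controlsP n Sw.
exists u => //; eexists; first exact: caratheodory_solution_Kset.
move=> t; rewrite /= in_itv/= => /andP[t0 tT].
rewrite uE primitive_word_control (@primitive_step_fun_eq _ _ w n) ?(le_trans tT)//.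
  exact: Qset_expRN.
exact: Sigma_sign_word.
Qed.

(** From $e^{t/2} \ge t/2$ one gets $e^t \ge t^2/4$. The factor [t + t] bounds the difference of two
    primitives of words at time [t]. *)
Lemma expRN_linear_bound (R : realType) (t : R) : 0 < t ->
  expR (- t) * (t + t) <= 8 / t.
Proof.
move=> t0; rewrite ler_pdivlMr//.
have e2 : t / 2 <= expR (t / 2).
  by rewrite (le_trans _ (expR_ge1Dx _))// lerDr.
have e1 : (t / 2) ^+ 2 <= expR t.
  rewrite [in leRHS](_ : t = t / 2 + t / 2); last by field.
  by rewrite expRD expr2 ler_pM// divr_ge0// ltW.
have -> : expR (- t) * (t + t) * t = expR (- t) * (t / 2) ^+ 2 * 8 by field.
rewrite -[leRHS]mul1r ler_wpM2r// -[leRHS](expRxMexpNx_1 t) mulrC.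
by rewrite ler_wpM2r ?expR_ge0.
Qed.

(** The trajectory is compared with the point [p] of [Q] having the same z and c. They coincide up
    to time [n]; later their distance is at most $2t e^{-t} \le 8/t \le 8/n$. *)
Lemma spanning_nbhd (R : realType) (n : nat) (T eps : R) : (0 < n)%N -> 8 / n%:R < eps ->
  spanning (field R) T (Kset R) (nbhd eps (Qset R)) (word_controls R n).
Proof.
move=> n0 neps _ [_ [w Sw <-] <-]; have [u uS [b uE bw]] := word_controlsP n Sw.
exists u => //; eexists; first exact: caratheodory_solution_Kset.
move=> t; rewrite /= in_itv/= => /andP[t0 tT]; rewrite uE primitive_word_control.
rewrite /nbhd/= /dist_to.
have e0 : 0 < eps by rewrite (le_lt_trans _ neps)// divr_ge0.
set x := vec3 _ _ _.
pose p := vec3 (expR (- t)) (coding w) (expR (- t) * primitive (step_fun w) t).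
apply: (@le_lt_trans _ _ (eucl_dist x p)%:E).
  by apply: ereal_inf_lbound; exists p => //; exact: Qset_expRN.
rewrite lte_fin /eucl_dist !big_ord_recl big_ord0 !mxE/= !subrr expr0n/= !add0r addr0.
rewrite sqrtr_sqr -mulrBr normrM (ger0_norm (expR_ge0 _)).
have [tn|nt] := leP t n%:R.
  rewrite (@primitive_step_fun_eq _ _ w n) ?subrr ?normr0 ?mulr0//.
  exact: Sigma_sign_word.
have {}t0 : 0 < t by apply: lt_trans nt; rewrite ltr0n.
apply: (le_lt_trans _ neps); apply: (@le_trans _ _ (8 / t)); last first.
  by rewrite ler_wpM2l// lef_pV2 ?posrE ?ltr0n// ltW.
apply: le_trans (expRN_linear_bound t0); rewrite ler_wpM2l ?expR_ge0//.
rewrite (le_trans (ler_normB _ _))// lerD// primitive_step_fun_le ?ltW//.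
exact: Sigma_sign_word.
Qed.

(** * Lower bound for strictly spanning sets *)

(** Here [phi] is an arbitrary solution, so uniqueness is needed. Membership in [Q] supplies the
    bound on z that [relaxation_unique] requires; with z and c known, the graph of [F] then
    determines y. *)
Lemma Qset_trajectory (R : realType) (u : control (Urange R)) (w : nat -> R)
    (phi : R -> 'rV[R]_3) (T : R) : Sigma R w ->
  caratheodory_solution (field R) (vec3 1 (coding w) 0) u phi ->
  (forall t, 0 <= t <= T -> Qset R (phi t)) ->
  forall t, 0 <= t <= T ->
    phi t ord0 0 = expR (- t) /\
    phi t ord0 2 = expR (- t) * primitive (step_fun w) t.
Proof.
move=> Sw sol phiQ.
have zE t : 0 <= t <= T -> phi t ord0 0 = expR (- t).
  move=> tT; rewrite -[RHS]mul1r.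
  apply: (@relaxation_unique R (fun s => phi s ord0 0) 1 1 T) tT => s /[dup] sT /andP[s0 _].
  - have [fi _] := sol s s0 0.
    by apply: eq_integrable_upto fi => r _; rewrite !mxE.
  - have [_ ->] := sol s s0 0; rewrite [X in X + _]mxE/=; congr (_ + _).
    by apply: eq_primitive => r _; rewrite !mxE.
  - have [z + [c _ <-]] := phiQ _ sT; rewrite mxE/= in_itv/= => /andP[z0 z1].
    by rewrite ger0_norm.
move=> t /[dup] tT /andP[t0 _]; split; first exact: zE.
have cE : phi t ord0 1 = coding w.
  have [_ ->] := sol t t0 1; rewrite [X in X + _]mxE/=.
  rewrite -[X in X + _]/(coding w) -[RHS]addr0; congr (_ + _).
  transitivity (primitive (fun=> 0 : R) t); first by apply: eq_primitive => r _; rewrite !mxE.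
  by rewrite /primitive Rintegral_cst ?mul0r//; exact: measurable_itv_lebT.
have [z _ [c _ phiE]] := phiQ _ tT.
have := zE _ tT; move: cE; rewrite -phiE !mxE/= => -> ->.
by have := matching_F_expRN t Sw ltr01; rewrite !mul1r ln1 subr0.
Qed.

(** Under a common control the difference of the y-components solves $D' = -D$, $D(0) = 0$, and
    vanishes. The primitives of both words thus agree up to [T], and their increments over $[j,j+1]$
    are the symbols. *)
Lemma stays_in_Qset_symbols (R : realType) (u : control (Urange R)) (w w' : nat -> R)
    (T : R) (n : nat) : Sigma R w -> Sigma R w' -> n%:R <= T ->
  stays_in (field R) `[0, T] (Qset R) (vec3 1 (coding w) 0) u ->
  stays_in (field R) `[0, T] (Qset R) (vec3 1 (coding w') 0) u ->
  forall j, (j < n)%N -> w j = w' j.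
Proof.
move=> Sw Sw' nT [phi sol phiQ] [phi' sol' phiQ'].
have {}phiQ t : 0 <= t <= T -> Qset R (phi t) by move=> tT; apply: phiQ; rewrite /= in_itv.
have {}phiQ' t : 0 <= t <= T -> Qset R (phi' t) by move=> tT; apply: phiQ'; rewrite /= in_itv.
have tr := Qset_trajectory Sw sol phiQ; have tr' := Qset_trajectory Sw' sol' phiQ'.
pose D t := phi t ord0 2 - phi' t ord0 2.
have DE t : 0 <= t <= T -> D t = 0.
  move=> tT; rewrite -[RHS](mul0r (expR (- t))).
  (* The control term cancels because both z-components are $e^{-r}$. *)
  have Dint s r : 0 <= s <= T -> 0 <= r <= s ->
      field R (phi r) (u r) ord0 2 - field R (phi' r) (u r) ord0 2 = - D r.
    move=> /andP[s0 sT] /andP[r0 rs]; have rT : 0 <= r <= T by rewrite r0 (le_trans rs).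
    by rewrite !mxE/= (tr _ rT).1 (tr' _ rT).1 /D; ring.
  apply: (@relaxation_unique R D 0 (T + T) T) tT => s /[dup] sT /andP[s0 sT'].
  - have [fi _] := sol s s0 2; have [fi' _] := sol' s s0 2.
    by apply: eq_integrable_upto (integrable_uptoB fi fi') => r; exact: Dint.
  - have [fi E] := sol s s0 2; have [fi' E'] := sol' s s0 2.
    rewrite add0r {1}/D E E' -(eq_primitive (Dint s ^~ sT)) primitiveB//.
    by rewrite !mxE/= !add0r.
  - rewrite /D (tr _ sT).2 (tr' _ sT).2 (le_trans (ler_normB _ _))//.
    have e1 : expR (- s) <= 1 by rewrite expR_le1 oppr_le0.
    by rewrite lerD// normrM (ger0_norm (expR_ge0 _)) -[leRHS]mul1r ler_pM ?expR_ge0//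
      (le_trans (primitive_step_fun_le _ s0)).
have qE t : 0 <= t <= T -> primitive (step_fun w) t = primitive (step_fun w') t.
  move=> tT; have := DE _ tT; rewrite /D (tr _ tT).2 (tr' _ tT).2 => /eqP.
  by rewrite subr_eq0 => /eqP /(mulfI (lt0r_neq0 (expR_gt0 _))).
move=> j jn; have jT : j.+1%:R <= T by rewrite (le_trans _ nT)// ler_nat.
have jj : j%:R <= j.+1%:R :> R by rewrite ler_nat.
have := step_fun_piece0 Sw (lexx _) jj (lexx _).
have := step_fun_piece0 Sw' (lexx _) jj (lexx _).
rewrite !qE ?ler0n ?(le_trans jj)// -natr1 [_ + 1]addrC addrK !mulr1 => <-.
by move=> /esym.
Qed.

(** Selecting from [S] a control for each binary word of length [n] is injective, since the control
    determines these symbols. *)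
Lemma spanning_card_ge (R : realType) (S : {fset control (Urange R)}) (T : R) (n : nat) :
  n%:R <= T -> spanning (field R) T (Kset R) (Qset R) S -> (2 ^ n <= #|` S|)%N.
Proof.
move=> nT spS.
pose w (b : {ffun 'I_n -> bool}) := sign_word R (extend_word b).
have Sw b : Sigma R (w b) by exact: Sigma_sign_word.
have /(_ _)/cid2-/all_sig2[f fS fQ] : forall b, exists2 u, u \in S &
    stays_in (field R) `[0, T] (Qset R) (vec3 1 (coding (w b)) 0) u.
  by move=> b; apply: spS; exists (coding (w b)) => //; exists (w b).
have f_inj : injective f.
  move=> b b' bb'; have := stays_in_Qset_symbols (Sw b) (Sw b') nT (fQ b).
  rewrite bb' => /(_ (fQ b')) ww'; apply/ffunP => i.
  have := ww' i (ltn_ord i); rewrite /w /sign_word /extend_word !valK.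
  have n11 : (1 : R) <> -1 by lra.
  by case: (b i); case: (b' i) => // /esym.
have <- : #|` [fset f b | b : {ffun 'I_n -> bool} in predT]%fset| = (2 ^ n)%N.
  by rewrite card_imfset//= -cardE card_ffun card_bool card_ord.
by apply: fsubset_leq_card; apply/fsubsetP => _ /imfsetP[b _ ->].
Qed.

(** * Entropies *)

(** The upper limit is an infimum over the sets of the filter: the set where [f] is at most [l + e]
    is one of them, and each of them meets the set where [f] is at least [l - e]. *)
Lemma limf_esup_pinfty (R : realType) (f : R -> \bar R) (l : R) :
  (forall e, 0 < e -> \forall t \near +oo, (f t <= (l + e)%:E)%E) ->
  (forall e, 0 < e -> \forall t \near +oo, ((l - e)%:E <= f t)%E) ->
  limf_esup f (pinfty_nbhs R) = l%:E.
Proof.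
move=> fle fge; apply/eqP; rewrite eq_le; apply/andP; split.
  apply/lee_addgt0Pr => e e0; rewrite -EFinD.
  apply: (@le_trans _ _ (ereal_sup (f @` [set t | (f t <= (l + e)%:E)%E]))).
    by apply: ereal_inf_lbound; eexists; [exact: (fle _ e0)|].
  by apply: ge_ereal_sup => _ [t ft <-].
apply/lee_subgt0Pr => e e0; rewrite -EFinB.
apply: le_ereal_inf_tmp => _ [V FV <-].
have [t [Vt ft]] := filter_ex (filterI FV (fge _ e0)).
by apply: (le_trans ft); apply: ereal_sup_ubound; exists t.
Qed.

Lemma lne_min_card_le (R : realType) (n : nat) (T : R) (K A : set 'rV[R]_3) :
  spanning (field R) T K A (word_controls R n) ->
  (lne (min_card_spanning (Urange R) (field R) T K A) <= (n%:R * ln 2)%:E)%E.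
Proof.
move=> sp.
have n2 : 0 < 2 ^+ n :> R by rewrite exprn_gt0.
rewrite mulr_natl -lnXn// -lne_EFin// lee_lne ?in_itv/= ?leey ?andbT; last 2 first.
- by apply: le_ereal_inf_tmp => _ [S _ <-]; rewrite lee_fin ler0n.
- by rewrite lee_fin ltW.
apply: (@le_trans _ _ (#|` word_controls R n|%:R)%:E).
  by apply: ereal_inf_lbound; exists (word_controls R n).
by rewrite lee_fin -natrX ler_nat card_word_controls.
Qed.

(** Covers the case without finite spanning sets, where the infimum is [+oo]. *)
Lemma lne_min_card_ge (R : realType) (n : nat) (T : R) (K A : set 'rV[R]_3) :
  (forall S : {fset control (Urange R)}, spanning (field R) T K A S -> (2 ^ n <= #|` S|)%N) ->
  ((n%:R * ln 2)%:E <= lne (min_card_spanning (Urange R) (field R) T K A))%E.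
Proof.
move=> sp.
have n2 : 0 < 2 ^+ n :> R by rewrite exprn_gt0.
rewrite mulr_natl -lnXn// -lne_EFin// lee_lne ?in_itv/= ?leey ?andbT; last 2 first.
- by rewrite lee_fin ltW.
- by apply: le_ereal_inf_tmp => _ [S _ <-]; rewrite lee_fin ler0n.
apply: le_ereal_inf_tmp => _ [S /sp nS <-].
by rewrite lee_fin -natrX ler_nat.
Qed.

Lemma h_inv_strict_Qset (R : realType) :
  h_inv_strict (Urange R) (field R) (Kset R) (Qset R) = (ln 2)%:E.
Proof.
have l2 : 0 <= ln 2 :> R by rewrite ln_ge0// ler1n.
apply: limf_esup_pinfty => e e0; near=> T.
- have T0 : 0 < T by near: T; exact: nbhs_pinfty_gt.
  have Te : ln 2 / e <= T by near: T; apply: nbhs_pinfty_ge; exact: num_real.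
  (* [n <= T + 1], and the surplus [ln 2 / T] is at most [e] by the choice of [T]. *)
  pose n := (Num.trunc T).+1.
  have Tn : T <= n%:R by exact/ltW/truncnS_gt.
  have nT : n%:R <= T + 1.
    by rewrite -natr1 lerD2r; have /andP[] := truncn_itv (ltW T0).
  apply: (@le_trans _ _ (T^-1%:E * (n%:R * ln 2)%:E)%E).
    apply: lee_wpmul2l; first by rewrite lee_fin invr_ge0 ltW.
    by apply: lne_min_card_le; exact: spanning_strict.
  rewrite -EFinM lee_fin mulrC ler_pdivrMr//.
  move: Te; rewrite ler_pdivrMr// => Te; nra.
- have T0 : 0 < T by near: T; exact: nbhs_pinfty_gt.
  have Te : ln 2 / e <= T by near: T; apply: nbhs_pinfty_ge; exact: num_real.
  (* Rounding down loses at most one symbol, again a deficit of at most [ln 2 / T]. *)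
  pose n := Num.trunc T.
  have Tn : T <= n%:R + 1 by rewrite natr1; exact/ltW/truncnS_gt.
  have nT : n%:R <= T by have /andP[] := truncn_itv (ltW T0).
  apply: (@le_trans _ _ (T^-1%:E * (n%:R * ln 2)%:E)%E); last first.
    apply: lee_wpmul2l; first by rewrite lee_fin invr_ge0 ltW.
    apply: lne_min_card_ge => S.
    exact: spanning_card_ge.
  rewrite -EFinM lee_fin mulrC ler_pdivlMr//.
  move: Te; rewrite ler_pdivrMr// => Te; nra.
Unshelve. all: by end_near. Qed.

Lemma h_inv_eps_Qset (R : realType) (eps : R) : 0 < eps ->
  h_inv_eps (Urange R) (field R) eps (Kset R) (Qset R) = 0%E.
Proof.
(* The word length is fixed before [T] tends to infinity, so the logarithm of the cardinality stays
   bounded. *)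
move=> eps0; pose n := (Num.trunc (8 / eps)).+1.
have n0 : 0 < n%:R :> R by rewrite ltr0n.
have neps : 8 / n%:R < eps.
  by rewrite ltr_pdivrMr// mulrC -ltr_pdivrMr// truncnS_gt.
apply: limf_esup_pinfty => e e0; near=> T.
- have T0 : 0 < T by near: T; exact: nbhs_pinfty_gt.
  have Te : n%:R * ln 2 / e <= T by near: T; apply: nbhs_pinfty_ge; exact: num_real.
  apply: (@le_trans _ _ (T^-1%:E * (n%:R * ln 2)%:E)%E).
    apply: lee_wpmul2l; first by rewrite lee_fin invr_ge0 ltW.
    by apply: lne_min_card_le; exact: spanning_nbhd.
  by rewrite -EFinM lee_fin add0r mulrC ler_pdivrMr// [leRHS]mulrC -ler_pdivrMr.
- have T0 : 0 < T by near: T; exact: nbhs_pinfty_gt.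
  apply: (@le_trans _ _ 0%E); first by rewrite lee_fin sub0r oppr_le0 ltW.
  apply: mule_ge0; first by rewrite lee_fin invr_ge0 ltW.
  (* A spanning set has at least $2^0 = 1$ element because [K] is nonempty; this keeps the logarithm
     nonnegative. *)
  have -> : (0 = (0%:R * ln 2)%:E :> \bar R)%E by rewrite mul0r.
  apply: lne_min_card_ge => S spS; rewrite expn0 cardfs_gt0.
  have Kc : Kset R (vec3 1 (coding (sign_word R xpredT)) 0).
    exists (coding (sign_word R xpredT)) => //; exists (sign_word R xpredT) => //.
    exact: Sigma_sign_word.
  have [u uS _] := spS _ Kc.
  by apply/fset0Pn; exists u.
Unshelve. all: by end_near. Qed.

Lemma h_inv_Qset (R : realType) :
  h_inv (Urange R) (field R) (Kset R) (Qset R) = 0%E.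
Proof.
apply: lim_near_cst => //; near=> eps; apply: h_inv_eps_Qset.
by near: eps; exact: nbhs_right_gt.
Unshelve. all: by end_near. Qed.

Theorem theorem3p1 (R : realType) :
  let U := Urange R in let f := field R in
  let K := Kset R in let Q := Qset R in
  [/\ compact K, compact Q, K `<=` Q & weakly_invariant U f Q] /\
  [/\ h_inv U f K Q = 0%E,
      h_inv_strict U f K Q = (ln 2)%:E,
      (h_inv_strict U f K Q < +oo)%E &
      h_inv U f K Q <> h_inv_strict U f K Q].
Proof.
move=> U f K Q; split; split.
- exact: compact_Kset.
- exact: compact_Qset.
- exact: Kset_sub_Qset.
- exact: weakly_invariant_Qset.
- exact: h_inv_Qset.
- exact: h_inv_strict_Qset.
- by rewrite h_inv_strict_Qset ltry.
- rewrite h_inv_Qset h_inv_strict_Qset => -[] /esym/eqP.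
  by rewrite gt_eqF// ln_gt0// ltr1n.
Qed.
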